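(* Let $\mu_1,\mu_2,\mu_3,\mu_4$ be four mass distributions in $\mathbb{R}^2$. Then there exist two lines $\ell_1,\ell_2$ (where a line at infinity is allowed) such that $\{\ell_1,\ell_2\}$ simultaneously bisects $\mu_1,\mu_2,\mu_3,\mu_4$.
   Context: A mass distribution $\mu$ on $\mathbb{R}^d$ is a measure on $\mathbb{R}^d$ such that all open subsets are measurable, $0<\mu(\mathbb{R}^d)<\infty$, and $\mu(S)=0$ for every lower-dimensional subset $S$ of $\mathbb{R}^d$. For a finite set $\mathcal{L}$ of oriented hyperplanes (lines when $d=2$), each $\ell\in\mathcal{L}$ has a positive side $\ell^+=\{x: g_\ell(x)\ge 0\}$ and negative side $\ell^-$, where $g_\ell(x)=a_1x_1+\dots+a_dx_d+a_0$ is a defining affine function; hyperplanes at infinity (where $g_\ell\equiv a_0$ is a nonzero constant) are allowed, for which $\ell^+=\mathbb{R}^d$ and $\ell^-=\emptyset$. For $p\in\mathbb{R}^d$ let $\lambda(p)=|\{\ell\in\mathcal{L}: p\in\ell^+\}|$, $R^+=\{p:\lambda(p)\text{ even}\}$, $R^-=\{p:\lambda(p)\text{ odd}\}$. $\mathcal{L}$ simultaneously bisects $\mu_1,\dots,\mu_k$ if $\mu_i(R^+)=\mu_i(R^-)$ for all $i$. A set of unoriented hyperplanes simultaneously bisects the measures if some orientation of them does (equivalently every orientation does). *)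

(* Defs.v *)
From HB Require Import structures.
From mathcomp Require Import all_boot all_order all_algebra.
From mathcomp Require Import all_classical all_reals all_analysis.
Set Implicit Arguments. Unset Strict Implicit. Unset Printing Implicit Defensive.
Import Order.TTheory GRing.Theory Num.Theory.
Local Open Scope classical_set_scope.
Local Open Scope ring_scope.

(* The plane R^2 is modelled as R * R, with the product sigma-algebra of the
   Borel sigma-algebras (= the Borel sigma-algebra of R^2, so every open set is
   measurable). *)

(* An oriented line (possibly at infinity) is given by the coefficients
   ((a1, a2), a0) of its defining affine function
   g(x) = a1 x1 + a2 x2 + a0, not all zero.  If a1 = a2 = 0 it is the line
   at infinity. *)
Definition aff_fun (R : realType) (l : R * R * R) (p : R * R) : R :=
  l.1.1 * p.1 + l.1.2 * p.2 + l.2.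

Definition oline_nondeg (R : realType) (l : R * R * R) : Prop :=
  l != (0, 0, 0).

Definition pos_side (R : realType) (l : R * R * R) : set (R * R) :=
  [set p | 0 <= aff_fun l p].

Definition lam (R : realType) (L : seq (R * R * R)) (p : R * R) : nat :=
  count (fun l => 0 <= aff_fun l p) L.

Definition Rplus (R : realType) (L : seq (R * R * R)) : set (R * R) :=
  [set p | ~~ odd (lam L p)].
Definition Rminus (R : realType) (L : seq (R * R * R)) : set (R * R) :=
  [set p | odd (lam L p)].

Definition sim_bisects (R : realType) (L : seq (R * R * R))
  (mu : set (R * R) -> \bar R) : Prop :=
  mu (Rplus L) = mu (Rminus L).

Definition mass_distribution (R : realType)
  (mu : {measure set (R * R)%type -> \bar R}) : Prop :=
  [/\ (0 < mu setT)%E, (mu setT < +oo)%E &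
      forall (a b c : R) (S : set (R * R)), (a, b) != (0, 0) ->
        measurable S -> S `<=` [set p | a * p.1 + b * p.2 + c = 0] ->
        mu S = 0%E].

(* Main.v *)
(** A pair of lines is a pair [p] of nonzero vectors of R^3, and each measure
    gives a function, the measure of { g1 g2 > 0 } minus that of
    { g1 g2 < 0 }, which is continuous, symmetric in the two lines and odd in
    each of them.  The common zero of the four functions comes from a
    Borsuk-Ulam argument modulo 2.  Let [tau] change the sign of the first
    line, and work modulo the group generated by the swap and by [p |-> - p],
    which preserves the functions.  In a triangulated product of two octahedra
    there are chains A_0, ..., A_4 over F_2 with A_0 a single vertex and
    boundary A_(k+1) = A_k + tau A_k.  Label a point by the sign and the index
    of a largest function there, on an iterated barycentric subdivision.  If
    no edge had opposite labels, Fan's identity would make the parity of the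
    number of alternating simplices of A_k independent of k; but it is 1 for
    A_0, and 0 for A_4 since five distinct indices are impossible.  Hence every
    subdivision has an edge with opposite labels, and these edges accumulate
    at a common zero. *)

Require Import Defs.
From HB Require Import structures.
From mathcomp Require Import all_boot all_order all_algebra.
From mathcomp Require Import all_classical all_reals all_analysis measurable_realfun.
From mathcomp Require Import ring lra.
Import Order.TTheory GRing.Theory Num.Theory.
Local Open Scope classical_set_scope.
Local Open Scope ring_scope.
Set Implicit Arguments. Unset Strict Implicit. Unset Printing Implicit Defensive.
Import numFieldNormedType.Exports.

(** * Chains modulo 2 and their boundary *)

Section Chains.
Variable V : eqType.
Implicit Types (s t : seq V) (c : seq (seq V)) (phi psi : seq V -> bool).

(** A list of simplices stands for a chain over F_2 and [phi] for a cochain. Identities between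
    chains are stated as equalities of values of [ev phi], so lists are compared without being
    normalised. *)
Definition ev phi c : bool := \big[addb/false]_(s <- c) phi s.

(** Modulo 2 the facets carry no signs. A vertex has the empty simplex as its boundary, as in the
    augmented complex. *)
Fixpoint bnd s : seq (seq V) :=
  if s is x :: s' then s' :: map (cons x) (bnd s') else [::].

Lemma ev_cons phi s c : ev phi (s :: c) = phi s (+) ev phi c.
Proof. by rewrite /ev big_cons. Qed.

Lemma ev_cat phi c d : ev phi (c ++ d) = ev phi c (+) ev phi d.
Proof. by rewrite /ev big_cat. Qed.

Lemma ev_addb phi psi c :
  ev (fun s => phi s (+) psi s) c = ev phi c (+) ev psi c.
Proof. by rewrite /ev big_split. Qed.

Lemma ev_count phi c : ev phi c = odd (count phi c).
Proof.
elim: c => [|s c IH]; first by rewrite /ev big_nil.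
by rewrite ev_cons IH /= oddD; case: (phi s).
Qed.

Lemma eq_ev phi psi c : {in c, phi =1 psi} -> ev phi c = ev psi c.
Proof. by move=> e; apply: eq_big_seq. Qed.

Lemma ev_flatten phi (U : eqType) (F : seq U -> seq (seq V)) (d : seq (seq U)) :
  ev phi (flatten (map F d)) = \big[addb/false]_(u <- d) ev phi (F u).
Proof. by rewrite /ev big_flatten big_map. Qed.

Lemma size_bnd s t : t \in bnd s -> (size t).+1 = size s.
Proof.
elim: s t => [|x s IH] t //=; rewrite inE => /orP[/eqP -> //|/mapP[u uin ->]].
by rewrite /= (IH _ uin).
Qed.

Lemma sub_bnd s t : t \in bnd s -> {subset t <= s}.
Proof.
elim: s t => [|x s IH] t //=; rewrite inE => /orP[/eqP -> y ys|/mapP[u uin ->] y].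
  by rewrite inE ys orbT.
by rewrite !inE => /orP[->//|/(IH _ uin) ->]; rewrite orbT.
Qed.
End Chains.

Lemma ev_map (U V : eqType) (phi : seq V -> bool) (f : seq U -> seq V)
    (c : seq (seq U)) :
  ev phi (map f c) = ev (phi \o f) c.
Proof. by rewrite /ev big_map. Qed.

Lemma bnd_map (U V : eqType) (f : U -> V) (s : seq U) :
  bnd (map f s) = map (map f) (bnd s).
Proof. by elim: s => //= x s ->; rewrite -!map_comp. Qed.

(** View [x :: s] as a cone over [s]. Each facet [t] of [s] arises twice, from the base and from the
    cone [x :: t], and cancels; what remains is the cone over the double boundary of [s], zero by
    induction. *)
Lemma bnd_bnd (V : eqType) (phi : seq V -> bool) (s : seq V) :
  ev (fun t => ev phi (bnd t)) (bnd s) = false.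
Proof.
elim: s phi => [|x s IH] phi /=; first by rewrite /ev big_nil.
rewrite ev_cons ev_map.
rewrite (_ : _ \o _ = fun t => phi t (+) ev (phi \o cons x) (bnd t)).
  by rewrite ev_addb IH addbF addbb.
by apply/funext => t /=; rewrite ev_cons ev_map.
Qed.

(** * Barycentric subdivision as an equivariant chain map *)

Section Subdivision.
Variables (K : fieldType) (V : lmodType K).
Implicit Types (s t : seq V) (phi : seq V -> bool).

Definition bary s : V := (size s)%:R^-1 *: \sum_(x <- s) x.

(* Barycentric subdivision of a simplex with [n] vertices, as the cone from
   the barycentre over the subdivided boundary. *)
Fixpoint sd n s : seq (seq V) :=
  if n is m.+1 then map (cons (bary s)) (flatten (map (sd m) (bnd s)))
  else [:: s].

Fixpoint sdi r n s : seq (seq V) :=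
  if r is q.+1 then flatten (map (sdi q n) (sd n s)) else [:: s].

Lemma mem_sd n s t : t \in sd n.+1 s ->
  exists u v, [/\ u \in bnd s, v \in sd n u & t = bary s :: v].
Proof.
by move=> /mapP[v /flattenP[c /mapP[u us ->] vu] ->]; exists u, v.
Qed.

Lemma size_sd n s t : t \in sd n s -> size t = (n + (size s - n))%N.
Proof.
elim: n s t => [|n IH] s t.
  by rewrite inE => /eqP ->; rewrite subn0.
move=> /mem_sd[u [v [us vu ->]]] /=.
by rewrite (IH _ _ vu) -(size_bnd us) subSS addSn.
Qed.

(** The boundary of the cone over the subdivided boundary is its base plus a cone over the boundary
    of that base. By induction the latter is the subdivision of a double boundary, so it
    vanishes. *)
Lemma bnd_sd phi n s : size s = n ->
  ev (fun t => ev phi (bnd t)) (sd n s) =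
  ev (fun t => ev phi (sd n.-1 t)) (bnd s).
Proof.
elim: n s phi => [|n IH] s phi szs /=.
  by case: s szs => //= _; rewrite /ev big_nil big_seq1 big_nil.
rewrite ev_map; set b := bary s.
rewrite (_ : _ \o _ = fun t => phi t (+) ev (phi \o cons b) (bnd t)); last first.
  by apply/funext => t /=; rewrite ev_cons ev_map.
rewrite ev_addb ev_flatten [X in _ (+) X](_ : _ = false) ?addbF //.
rewrite ev_flatten -[RHS](bnd_bnd (fun u => ev (phi \o cons b) (sd n.-1 u)) s).
apply: eq_ev => t ts; apply: IH.
by apply/succn_inj; rewrite (size_bnd ts).
Qed.

Lemma size_sdi r n s t : size s = n -> t \in sdi r n s -> size t = n.
Proof.
elim: r s t => [|r IH] s t szs /=; first by rewrite inE => /eqP ->.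
move=> /flattenP[c /mapP[u us ->] tu]; apply: (IH u) => //.
by rewrite (size_sd us) szs subnn addn0.
Qed.

Lemma bnd_sdi phi r n s : size s = n ->
  ev (fun t => ev phi (bnd t)) (sdi r n s) =
  ev (fun t => ev phi (sdi r n.-1 t)) (bnd s).
Proof.
elim: r s => [|r IH] s szs /=.
  rewrite {1}/ev big_seq1; apply: eq_ev => t _.
  by rewrite /ev big_seq1.
rewrite ev_flatten -/(ev _ _) (eq_ev (psi :=
  fun u => ev (fun t => ev phi (sdi r n.-1 t)) (bnd u))); last first.
  by move=> u us; apply: IH; rewrite (size_sd us) szs subnn addn0.
rewrite bnd_sd //; apply: eq_ev => t _.
by rewrite ev_flatten.
Qed.

Section Equivariance.
Variable g : {linear V -> V}.

Lemma bary_map s : bary (map g s) = g (bary s).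
Proof. by rewrite /bary size_map linearZ /= big_map (linear_sum g). Qed.

Lemma sd_map n s : sd n (map g s) = map (map g) (sd n s).
Proof.
elim: n s => [|n IH] s //=.
rewrite bary_map bnd_map -!map_comp.
rewrite (_ : map _ (bnd s) = map (map (map g)) (map (sd n) (bnd s))).
  by rewrite -map_flatten -!map_comp; apply: eq_map.
by rewrite -map_comp; apply: eq_map => t /=; rewrite IH.
Qed.

Lemma sdi_map r n s : sdi r n (map g s) = map (map g) (sdi r n s).
Proof.
elim: r s => [|r IH] s //=.
rewrite sd_map map_flatten -!map_comp; congr flatten.
by apply: eq_map => t /=; rewrite IH.
Qed.

End Equivariance.

(** The part of convexity that subdivision uses; it is applied to balls and to level sets of linear
    forms. *)
Definition bary_closed (C : V -> Prop) :=
  forall s, s != [::] -> (forall x, x \in s -> C x) -> C (bary s).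

Lemma sd_closed (C : V -> Prop) n s t : bary_closed C -> size s = n ->
  (forall x, x \in s -> C x) -> t \in sd n s -> forall x, x \in t -> C x.
Proof.
move=> barC; elim: n s t => [|n IH] s t szs sC; first by rewrite inE => /eqP ->.
move=> /mem_sd[u [v [us vu ->]]] x; rewrite inE => /orP[/eqP->|xv].
  by apply: barC => //; rewrite -size_eq0 szs.
apply: (IH u v) => // [|y yu]; last exact/sC/(sub_bnd us).
by apply/succn_inj; rewrite (size_bnd us).
Qed.

Lemma sdi_closed (C : V -> Prop) r n s t : bary_closed C -> size s = n ->
  (forall x, x \in s -> C x) -> t \in sdi r n s -> forall x, x \in t -> C x.
Proof.
move=> barC; elim: r s t => [|r IH] s t szs sC; first by rewrite inE => /eqP ->.
move=> /flattenP[c /mapP[u us ->] tu]; apply: (IH u) => //.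
  by rewrite (size_sd us) szs subnn addn0.
exact: (sd_closed barC szs sC us).
Qed.

End Subdivision.

(** * Mesh of the iterated subdivisions *)

Section Mesh.
Variables (R : realType) (V : normedModType R).
Implicit Types (s t : seq V).

Lemma bary_sub s (y : V) : s != [::] ->
  bary s - y = (size s)%:R^-1 *: \sum_(x <- s) (x - y).
Proof.
move=> s0; rewrite sumrB scalerBr; congr (_ - _).
rewrite big_const_seq count_predT iter_addr_0 -[y *+ _]scaler_nat scalerA.
by rewrite mulVf ?scale1r // pnatr_eq0 size_eq0.
Qed.

Lemma closed_ball_bary (y : V) (D : R) : bary_closed (fun x => `|x - y| <= D).
Proof.
move=> s s0 sD; have n0 : 0 < (size s)%:R :> R by rewrite ltr0n lt0n size_eq0.
rewrite bary_sub // normrZ normfV ger0_norm ?ler0n // mulrC ler_pdivrMr //.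
rewrite (le_trans (ler_norm_sum _ _ _)) //.
apply: (@le_trans _ _ (\sum_(x <- s) D)).
  by rewrite big_seq [leRHS]big_seq; apply: ler_sum => x; apply: sD.
by rewrite big_const_seq count_predT iter_addr_0 mulr_natr.
Qed.

Definition diam_le (D : R) s := forall x y, x \in s -> y \in s -> `|x - y| <= D.

(** In the mean of the differences to [x] the term of [x] itself is zero, which gives the factor (n
    - 1) / n for n vertices. It is weakened to the common bound [N] so that one factor serves all
    faces. *)
Lemma bary_dist (D : R) N s x : (0 < N)%N -> (size s <= N)%N -> diam_le D s ->
  x \in s -> `|bary s - x| <= (1 - N%:R^-1) * D.
Proof.
move=> N0 sN sD xs; have s0 : s != [::] by case: (s) xs.
have n0 : 0 < (size s)%:R :> R by rewrite ltr0n lt0n size_eq0.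
have D0 : 0 <= D by rewrite (le_trans _ (sD _ _ xs xs)).
rewrite bary_sub // normrZ normfV ger0_norm ?ler0n // mulrC ler_pdivrMr //.
rewrite (big_rem x) //= subrr add0r (le_trans (ler_norm_sum _ _ _)) //.
apply: (@le_trans _ _ (\sum_(y <- rem x s) D)).
  rewrite big_seq [leRHS]big_seq; apply: ler_sum => y /mem_rem ys.
  exact: sD.
rewrite big_const_seq count_predT iter_addr_0 size_rem //.
rewrite -[D *+ _]mulr_natr [leRHS]mulrAC [leLHS]mulrC ler_wpM2r //.
rewrite mulrBl mul1r -subn1 natrB ?lerD2l ?lerN2; last by rewrite lt0n size_eq0.
by rewrite mulrC ler_pdivrMr ?ltr0n // mul1r ler_nat.
Qed.

(** Two vertices other than the apex lie in a subdivided facet, where induction applies. Distances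
    to the apex are bounded because a ball about [bary s] containing the vertices of a facet
    contains its subdivision. *)
Lemma sd_diam (D : R) N n s t : (0 < N)%N -> (n <= N)%N -> size s = n ->
  diam_le D s -> t \in sd n s -> diam_le ((1 - N%:R^-1) * D) t.
Proof.
move=> N0; elim: n s t => [|n IH] s t nN szs sD.
  by case: s szs sD => // _ _; rewrite inE => /eqP -> x.
move=> /mem_sd[u [v [us vu ->]]].
have szu : size u = n by apply/succn_inj; rewrite (size_bnd us).
have s0 : s != [::] by rewrite -size_eq0 szs.
have vD : diam_le ((1 - N%:R^-1) * D) v.
  apply: (IH u) => //; first exact: ltnW.
  by move=> x y /(sub_bnd us) xs /(sub_bnd us); apply: sD.
have bD x : x \in v -> `|x - bary s| <= (1 - N%:R^-1) * D.
  apply: (sd_closed (@closed_ball_bary (bary s) _) szu _ vu) => y /(sub_bnd us) ys.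
  by rewrite distrC; apply: bary_dist; rewrite ?szs.
have D0 : 0 <= (1 - N%:R^-1) * D.
  case: (s) s0 (sD) (szs) => // x s' _ sD' szs'.
  by rewrite (le_trans _ (bary_dist N0 _ sD' (mem_head _ _))) ?szs'.
move=> x y; rewrite !inE => /orP[/eqP->|xv] /orP[/eqP->|yv].
- by rewrite subrr normr0.
- by rewrite distrC bD.
- exact: bD.
- exact: vD.
Qed.

Lemma sdi_diam (D : R) N r n s t : (0 < N)%N -> (n <= N)%N -> size s = n ->
  diam_le D s -> t \in sdi r n s -> diam_le ((1 - N%:R^-1) ^+ r * D) t.
Proof.
move=> N0 nN; elim: r D s t => [|r IH] D s t szs sD.
  by rewrite inE mul1r => /eqP ->.
move=> /flattenP[c /mapP[u us ->] tu].
rewrite exprSr -mulrA; apply: (IH _ u) => //.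
  by rewrite (size_sd us) szs subnn addn0.
exact: sd_diam us.
Qed.

End Mesh.

(** * Fan's lemma for labellings by [+-0 .. +-3] *)

Definition label := (nat * bool)%type.

Definition opp_label (l : label) : label := (l.1, ~~ l.2).

Definition complementary (t : seq label) : bool :=
  has (fun l => opp_label l \in t) t.

(** Fan's alternating simplices; [b] is the sign at the smallest index, [true] being the positive
    sign. *)
Definition alternating (b : bool) (t : seq label) : bool :=
  if sort (fun l m => l.1 <= m.1)%N t is l :: u then
    (l.2 == b) && path (fun l m => (l.1 < m.1)%N && (l.2 != m.2)) l u
  else false.

Lemma alternating_opp b t :
  alternating b (map opp_label t) = alternating (~~ b) t.
Proof.
rewrite /alternating sort_map.
rewrite [sort (relpre _ _) t](_ : _ = sort (fun l m => (l.1 <= m.1)%N) t) //.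
case: (sort _ t) => [|l u] //=.
rewrite path_map; congr (_ && _); first by case: (l.2) b => [] [].
by apply: eq_path => x y /=; case: x.2 y.2 => [] [].
Qed.

Definition labels : seq label := [seq (i, b) | i <- iota 0 4, b <- [:: true; false]].

Fixpoint label_words n : seq (seq label) :=
  if n is m.+1 then [seq l :: t | l <- labels, t <- label_words m] else [:: [::]].

Lemma mem_label_words t : all (fun l : label => (l.1 < 4)%N) t ->
  t \in label_words (size t).
Proof.
elim: t => [|[i b] t IH] // /andP[i4 /IH tin].
rewrite (_ : label_words _ = [seq l :: u | l <- labels, u <- label_words (size t)]) //.
apply/allpairsP; exists ((i, b), t); split => //.
by case: i i4 => [|[|[|[|]]]] // _; case: b.
Qed.

Definition fan_check t :=
  complementary t ||
  (alternating true t (+) alternating false t ==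
   odd (count (alternating true) (bnd t))).

Lemma fan_check_words : all (fun n => all fan_check (label_words n)) [:: 2; 3; 4; 5]%N.
Proof. by vm_compute. Qed.

(** An alternating simplex has two alternating facets, without its lowest or its highest label, and
    they start with opposite signs. In a non-alternating simplex without complementary labels the
    positive alternating facets number zero or two. With eight labels this is checked on all words.
    A single vertex is excluded: it alternates, but its facet, the empty simplex, does not. *)
Lemma fan t : all (fun l : label => (l.1 < 4)%N) t -> (1 < size t < 6)%N ->
  ~~ complementary t ->
  alternating true t (+) alternating false t = ev (alternating true) (bnd t).
Proof.
move=> /mem_label_words tin szt nct.
have /allP/(_ (size t)) := fan_check_words.
have -> : size t \in [:: 2; 3; 4; 5]%N.
  by move: szt; case: (size t) => [|[|[|[|[|[|n]]]]]].
by move=> /(_ isT)/allP/(_ _ tin); rewrite /fan_check (negbTE nct) ev_count => /eqP.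
Qed.

Lemma alternating_size b t : all (fun l : label => (l.1 < 4)%N) t ->
  (4 < size t)%N -> alternating b t = false.
Proof.
move=> t4 szt; apply/negbTE/negP; rewrite /alternating.
have := mem_sort (fun l m : label => (l.1 <= m.1)%N) t.
have := size_sort (fun l m : label => (l.1 <= m.1)%N) t.
case: sort => // l u szu memu /andP[_ pth].
have : uniq (map fst (l :: u)).
  apply: (sorted_uniq ltn_trans ltnn); rewrite /= path_map.
  by apply: sub_path pth => x y /andP[].
move=> /(uniq_leq_size (s2 := iota 0 4)) le4.
have : (size (map fst (l :: u)) <= 4)%N.
  apply: le4 => _ /mapP[m mu ->]; rewrite mem_iota /= add0n.
  by move/allP: t4; apply; rewrite -memu.
by rewrite size_map szu leqNgt szt.
Qed.

(** * Chains in the product of two octahedra *)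

(** In a vertex [(b, i)] of an octahedron [true] is the negative sign, contrary to the convention
    for [label]. *)
Definition overt := ((bool * nat) * (bool * nat))%type.

Definition oopp (a : bool * nat) : bool * nat := (~~ a.1, a.2).
Definition oswap (v : overt) : overt := (v.2, v.1).
Definition oneg (v : overt) : overt := (oopp v.1, oopp v.2).
Definition otau (v : overt) : overt := (oopp v.1, v.2).

(* Digits 1, 2, 3 stand for the vertices e1, e2, e3 of the octahedron and
   4, 5, 6 for their opposites; a two-digit number is a pair of vertices.
   Every simplex is a chain for the product of the orders by index on the
   vertices of a face.  The lists solve, by linear algebra over F_2, the
   equations [half_chain_bnd] starting from one vertex. *)
Definition half_chain_codes : seq (seq (seq nat)) :=
  [::
  [:: [:: 22]];
  [:: [:: 14; 22]; [:: 14; 25]];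
  [:: [:: 11; 22; 26]; [:: 11; 25; 26]; [:: 14; 22; 26]; [:: 14; 25; 35]];
  [:: [:: 11; 21; 22; 23]; [:: 11; 21; 22; 26]; [:: 11; 21; 25; 23];
      [:: 11; 21; 25; 66]; [:: 11; 21; 26; 66]; [:: 11; 25; 26; 66];
      [:: 14; 12; 22; 26]; [:: 14; 12; 22; 33]; [:: 14; 12; 26; 66];
      [:: 14; 12; 52; 33]; [:: 14; 12; 52; 66]; [:: 14; 22; 23; 33];
      [:: 14; 24; 25; 33]; [:: 14; 24; 25; 35]; [:: 14; 24; 35; 33];
      [:: 14; 25; 23; 33]; [:: 21; 22; 23; 33]; [:: 21; 22; 26; 66];
      [:: 21; 22; 62; 66]; [:: 21; 25; 23; 33]; [:: 24; 25; 35; 33]];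
  [:: [:: 11; 15; 13; 23; 33]; [:: 11; 15; 13; 23; 63];
      [:: 11; 15; 13; 53; 33]; [:: 11; 15; 13; 53; 63];
      [:: 11; 15; 25; 23; 33]; [:: 11; 15; 25; 35; 33];
      [:: 11; 15; 25; 35; 36]; [:: 11; 15; 55; 35; 33];
      [:: 11; 15; 55; 35; 36]; [:: 11; 15; 55; 53; 33];
      [:: 11; 15; 55; 53; 63]; [:: 11; 21; 22; 23; 33];
      [:: 11; 21; 22; 26; 36]; [:: 11; 21; 22; 32; 33];
      [:: 11; 21; 25; 23; 33]; [:: 11; 21; 25; 26; 36];
      [:: 11; 21; 25; 26; 66]; [:: 11; 21; 25; 35; 33];
      [:: 11; 21; 25; 35; 36]; [:: 11; 21; 31; 32; 33];
      [:: 11; 21; 31; 32; 36]; [:: 11; 21; 31; 35; 33];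
      [:: 11; 21; 31; 35; 36]; [:: 14; 12; 13; 23; 33];
      [:: 14; 12; 13; 23; 63]; [:: 14; 12; 13; 53; 33];
      [:: 14; 12; 13; 53; 63]; [:: 14; 12; 22; 23; 33];
      [:: 14; 12; 22; 23; 63]; [:: 14; 12; 22; 26; 66];
      [:: 14; 12; 22; 62; 63]; [:: 14; 12; 22; 62; 66];
      [:: 14; 12; 52; 53; 33]; [:: 14; 12; 52; 53; 63];
      [:: 14; 12; 52; 62; 63]; [:: 14; 12; 52; 62; 66];
      [:: 14; 24; 22; 26; 66]; [:: 14; 24; 22; 62; 63];
      [:: 14; 24; 22; 62; 66]; [:: 14; 24; 25; 23; 63];
      [:: 14; 24; 25; 26; 66]; [:: 14; 24; 25; 35; 33];
      [:: 14; 24; 25; 65; 63]; [:: 14; 24; 25; 65; 66];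
      [:: 14; 24; 64; 62; 63]; [:: 14; 24; 64; 62; 66];
      [:: 14; 24; 64; 65; 63]; [:: 14; 24; 64; 65; 66]]].

Definition odigit (d : nat) : bool * nat := ((3 < d)%N, (d.-1 %% 3)%N).

Definition half_chain (k : nat) : seq (seq overt) :=
  map (map (fun n => (odigit (n %/ 10), odigit (n %% 10)))) (nth [::] half_chain_codes k).

Definition orbit4 (s : seq overt) : seq (seq overt) :=
  [:: s; map oswap s; map oneg s; map oswap (map oneg s)].

(** Crosses out the first simplex against a later one of its orbit until nothing is left, with fuel
    [n]. An invariant cochain agrees on the two, so success shows that it vanishes on the chain. *)
Fixpoint cancels n (c : seq (seq overt)) : bool :=
  if c is s :: d then
    if n is m.+1 then
      let i := find (mem (orbit4 s)) d in
      (i < size d)%N && cancels m (take i d ++ drop i.+1 d)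
    else false
  else true.

Lemma ev_cancels phi n c :
  (forall s, phi (map oswap s) = phi s) -> (forall s, phi (map oneg s) = phi s) ->
  cancels n c -> ev phi c = false.
Proof.
move=> phis phin; elim: n c => [|n IH] [|s d] //=; first by rewrite /ev big_nil.
  by rewrite /ev big_nil.
set i := find _ d => /andP[ilt /IH evd].
have : nth [::] d i \in orbit4 s by apply: nth_find; rewrite has_find.
move: evd; rewrite ev_cons /ev big_cat /= => evd io.
rewrite -[in X in _ (+) X](cat_take_drop i d) big_cat (drop_nth [::] ilt) big_cons /=.
have -> : phi (nth [::] d i) = phi s.
  by move: io; rewrite !inE => /or4P[] /eqP ->; rewrite ?phis ?phin.
by rewrite [X in _ (+) X]addbCA addbA addbb addFb.
Qed.

Lemma half_chain_cancels : all (fun k => cancels 500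
  (flatten (map (@bnd _) (half_chain k.+1)) ++
   half_chain k ++ map (map otau) (half_chain k))) (iota 0 4).
Proof. by vm_compute. Qed.

(* [oswap] and [oneg] generate the subgroup preserving the test functions. *)
Lemma half_chain_bnd phi k : (k < 4)%N ->
  (forall s, phi (map oswap s) = phi s) -> (forall s, phi (map oneg s) = phi s) ->
  ev (fun s => ev phi (bnd s)) (half_chain k.+1) =
  ev (fun s => phi s (+) phi (map otau s)) (half_chain k).
Proof.
move=> k4 phis phin; rewrite ev_addb.
have /allP/(_ k) := half_chain_cancels.
rewrite mem_iota => /(_ k4) /(ev_cancels phis phin).
move=> ev0; set X := ev _ (half_chain k.+1).
set Y := ev phi _; set Z := ev _ (half_chain k).
have : X (+) (Y (+) Z) = false.
  by rewrite -ev0 !ev_cat ev_flatten (ev_map _ (map otau)).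
by case: X Y Z => [] [] [].
Qed.

Lemma size_half_chain k s : (k < 5)%N -> s \in half_chain k -> size s = k.+1.
Proof.
have : all (fun k => all (fun s => size s == k.+1) (half_chain k)) (iota 0 5).
  by vm_compute.
by move=> /allP/(_ k) + k5; rewrite mem_iota => /(_ k5)/allP + sk => /(_ _ sk)/eqP.
Qed.

Definition signs : seq (bool * bool * bool) :=
  let bb := [:: true; false] in
  [seq (ab, c) | ab <- [seq (a, b) | a <- bb, b <- bb], c <- bb].

Definition on_face (e : bool * bool * bool) (a : bool * nat) : bool :=
  a.1 == match a.2 with 0%N => e.1.1 | 1%N => e.1.2 | _ => e.2 end.

(** Lying in a product of two faces keeps every subdivided simplex away from pairs with a zero
    component. *)
Lemma half_chain_face k s : (k < 5)%N -> s \in half_chain k ->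
  exists e1 e2, forall v, v \in s -> on_face e1 v.1 && on_face e2 v.2.
Proof.
have : all (fun k => all (fun s => has (fun e1 => has (fun e2 =>
    all (fun v => on_face e1 v.1 && on_face e2 v.2) s) signs) signs)
  (half_chain k)) (iota 0 5) by vm_compute.
move=> /allP/(_ k) + k5; rewrite mem_iota => /(_ k5)/allP + sk => /(_ _ sk).
by move=> /hasP[e1 _ /hasP[e2 _ /allP ok]]; exists e1, e2.
Qed.

(** * A Borsuk-Ulam theorem for pairs of lines *)

Section BorsukUlam.
Variable R : realType.
Local Notation V3 := (R * R * R)%type.
Local Notation V := (V3 * V3)%type.

Definition swap_pair (p : V) : V := (p.2, p.1).
Definition neg_fst (p : V) : V := (- p.1, p.2).

Lemma swap_pair_linear : linear swap_pair.
Proof. by []. Qed.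
HB.instance Definition _ := GRing.isLinear.Build R V V *:%R swap_pair swap_pair_linear.

Lemma neg_fst_linear : linear neg_fst.
Proof.
move=> a p q; rewrite /neg_fst; congr pair => /=.
by rewrite opprD scalerN.
Qed.
HB.instance Definition _ := GRing.isLinear.Build R V V *:%R neg_fst neg_fst_linear.

Definition ovec (a : bool * nat) : V3 :=
  (-1) ^+ a.1 *: match a.2 with
                 | 0%N => (1, 0, 0) | 1%N => (0, 1, 0) | _ => (0, 0, 1) end.

Definition opair (v : overt) : V := (ovec v.1, ovec v.2).

Lemma ovec_opp a : ovec (oopp a) = - ovec a.
Proof. by rewrite /ovec /= signrN scaleNr. Qed.

Lemma opair_swap v : opair (oswap v) = swap_pair (opair v).
Proof. by []. Qed.

Lemma opair_neg v : opair (oneg v) = - opair v.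
Proof. by rewrite /opair /= !ovec_opp. Qed.

Lemma opair_tau v : opair (otau v) = neg_fst (opair v).
Proof. by rewrite /opair /= ovec_opp. Qed.

Lemma norm_ovec a : `|ovec a| = 1.
Proof.
rewrite /ovec normrZ normrX normrN1 expr1n mul1r.
have m01 : Num.max 0 1 = 1 :> R by rewrite max_r.
have m10 : Num.max 1 0 = 1 :> R by rewrite max_l.
by case: a.2 => [|[|n]]; rewrite !prod_normE /= ?normr0 ?normr1 ?(m01, m10, maxxx).
Qed.

Lemma norm_opair v : `|opair v| = 1.
Proof. by rewrite prod_normE /= !norm_ovec maxxx. Qed.

Lemma norm_coords_le (x : V3) :
  [/\ `|x.1.1| <= `|x|, `|x.1.2| <= `|x| & `|x.2| <= `|x|].
Proof. by rewrite !prod_normE !le_max !lexx !orbT. Qed.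

(** The linear form equal to 1 on the face [e] of the octahedron. *)
Definition face_form (e : bool * bool * bool) (x : V3) : R :=
  (-1) ^+ e.1.1 * x.1.1 + (-1) ^+ e.1.2 * x.1.2 + (-1) ^+ e.2 * x.2.

Lemma face_formD e x y : face_form e (x + y) = face_form e x + face_form e y.
Proof. by rewrite /face_form !mulrDr; ring. Qed.

Lemma face_formZ e a x : face_form e (a *: x) = a * face_form e x.
Proof. by rewrite /face_form !mulrDr !(mulrCA a). Qed.

Lemma face_form_ovec e a : on_face e a -> face_form e (ovec a) = 1.
Proof.
rewrite /on_face /face_form /ovec => /eqP ->.
by case: a.2 => [|[|n]] /=; rewrite !scaler0 ?mulr0 ?addr0 ?add0r;
  rewrite /GRing.scale /= mulr1 -expr2 sqrr_sign.
Qed.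

Lemma face_form_le e x : face_form e x <= 3 * `|x|.
Proof.
have le1 b (y : R) : (-1) ^+ b * y <= `|y|.
  by rewrite (le_trans (ler_norm _)) // normrM normrX normrN1 expr1n mul1r.
have [n1 n2 n3] := norm_coords_le x.
rewrite /face_form; have := le1 e.1.1 x.1.1; have := le1 e.1.2 x.1.2.
by have := le1 e.2 x.2; lra.
Qed.

Lemma bary_closed_form (h : V -> R) : (forall x y, h (x + y) = h x + h y) ->
  (forall a x, h (a *: x) = a * h x) -> bary_closed (fun x => h x = 1).
Proof.
move=> hD hZ s s0 hs.
have h0 : h 0 = 0 by rewrite -(scale0r 0) hZ mul0r.
rewrite /bary hZ (big_morph h hD h0) big_seq (eq_bigr (fun=> 1)) //.
rewrite -big_seq big_const_seq count_predT iter_addr_0.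
by rewrite mulVf // pnatr_eq0 size_eq0.
Qed.

(** Subdivision stays in the unit ball and where the two face forms equal 1. A face form is at most
    three times the sup norm, so both components keep norm at least 1/3, uniformly in [r]. *)
Lemma half_chain_sdi r k s t p : (k < 5)%N -> s \in half_chain k ->
  t \in sdi r k.+1 (map opair s) -> p \in t ->
  [/\ `|p| <= 1, 1 <= 3 * `|p.1| & 1 <= 3 * `|p.2|].
Proof.
move=> k5 sk ts pt; have [e1 [e2 se]] := half_chain_face k5 sk.
have szs : size (map opair s) = k.+1 by rewrite size_map (size_half_chain k5).
split.
- rewrite -[p]subr0; apply: (sdi_closed (@closed_ball_bary _ V 0 1) szs _ ts pt).
  move=> _ /mapP[v vs ->].
  by rewrite subr0 norm_opair.
- suff h : face_form e1 p.1 = 1 by rewrite -[leLHS]h face_form_le.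
  have cl : bary_closed (fun p : V => face_form e1 p.1 = 1).
    by apply: bary_closed_form => *; rewrite (face_formD, face_formZ).
  apply: (sdi_closed cl szs _ ts pt) => _ /mapP[v vs ->].
  by have /andP[/face_form_ovec] := se _ vs.
- suff h : face_form e2 p.2 = 1 by rewrite -[leLHS]h face_form_le.
  have cl : bary_closed (fun p : V => face_form e2 p.2 = 1).
    by apply: bary_closed_form => *; rewrite (face_formD, face_formZ).
  apply: (sdi_closed cl szs _ ts pt) => _ /mapP[v vs ->].
  by have /andP[_ /face_form_ovec] := se _ vs.
Qed.

(** * Labels given by a largest test function *)

Definition max_label (v : 'I_4 -> R) : label :=
  let i := [arg max_(i > ord0) `|v i|]%O in (val i, 0 < v i).

Lemma max_label_lt v : ((max_label v).1 < 4)%N.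
Proof. exact: ltn_ord. Qed.

Lemma max_labelP v : exists i, [/\ max_label v = (val i, 0 < v i) &
  forall j, `|v j| <= `|v i|].
Proof.
exists [arg max_(i > ord0) `|v i|]%O; split => // j.
by case: arg_maxP => // i _; apply.
Qed.

(** The absolute values agree, so the same index is chosen; the entry there is nonzero, so its sign
    does flip. *)
Lemma max_label_opp v : (exists i, v i != 0) ->
  max_label (fun i => - v i) = opp_label (max_label v).
Proof.
move=> [j vj0]; rewrite /max_label /opp_label /=.
rewrite (_ : (fun i => `|- v i|) = (fun i => `|v i|)); last first.
  by apply/funext => i; rewrite normrN.
case: arg_maxP => // i _ /(_ j isT) le_ji.
rewrite oppr_gt0 -leNgt; congr pair.
by rewrite le_eqVlt (_ : (v i == 0) = false) //; apply/negbTE;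
  rewrite -normr_gt0 (lt_le_trans _ le_ji) // normr_gt0.
Qed.

Variable f : 'I_4 -> V -> R.
Hypothesis f_swap : forall i p, f i (swap_pair p) = f i p.
Hypothesis f_neg : forall i p, f i (neg_fst p) = - f i p.
Hypothesis f_nz : forall p : V, p.1 != 0 -> p.2 != 0 -> exists i, f i p != 0.

Let lab (p : V) : label := max_label (fun i => f i p).

Let lab_swap p : lab (swap_pair p) = lab p.
Proof. by rewrite /lab; congr max_label; apply/funext => i. Qed.

Let lab_opp p : lab (- p) = lab p.
Proof.
rewrite /lab; congr max_label; apply/funext => i.
have -> : - p = neg_fst (swap_pair (neg_fst (swap_pair p))) by case: p.
by rewrite f_neg f_swap f_neg f_swap opprK.
Qed.

Let lab_neg p : p.1 != 0 -> p.2 != 0 -> lab (neg_fst p) = opp_label (lab p).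
Proof.
move=> p1 p2; rewrite /lab -max_label_opp; last exact: f_nz.
by congr max_label; apply/funext => i.
Qed.

Let lab_lt t : all (fun l : label => (l.1 < 4)%N) (map lab t).
Proof. by apply/allP => _ /mapP[p _ ->]; apply: max_label_lt. Qed.

Let pm (t : seq V) := alternating true (map lab t) (+) alternating false (map lab t).

Lemma complementary_simplex r : exists k s t,
  [/\ (k < 5)%N, s \in half_chain k, t \in sdi r k.+1 (map opair s) &
      complementary (map lab t)].
Proof.
apply: contrapT => nocompl.
have nc k s t : (k < 5)%N -> s \in half_chain k ->
    t \in sdi r k.+1 (map opair s) -> ~~ complementary (map lab t).
  by move=> *; apply/negP => ?; apply: nocompl; exists k, s, t.
(* The parity of the number of alternating simplices in the subdivision of A_k. *)
pose a k := ev (fun s => ev pm (sdi r k.+1 (map opair s))) (half_chain k).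
(* Fan's identity passes to facets, and subdivision commutes with the boundary, so positive
   alternating simplices are counted on A_k + tau A_k. As tau flips labels, those of tau A_k are the
   negative ones of A_k. *)
have aS k : (k < 4)%N -> a k.+1 = a k.
  move=> k4; pose phi s := ev (alternating true \o map lab) (sdi r k.+1 (map opair s)).
  have -> : a k.+1 = ev (fun s => ev phi (bnd s)) (half_chain k.+1).
    apply: eq_ev => s sk.
    have szs : size (map opair s) = k.+2 by rewrite size_map (size_half_chain _ sk).
    rewrite (eq_ev (psi := fun t => ev (alternating true \o map lab) (bnd t))).
      by rewrite bnd_sdi // bnd_map (ev_map _ (map opair)).
    move=> t ts; rewrite /pm fan ?lab_lt //.
    - by rewrite bnd_map (ev_map _ (map lab)).
    - by rewrite size_map (size_sdi szs ts) /= ltnS.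
    - exact: (nc _ _ _ _ sk ts).
  rewrite half_chain_bnd //.
  - apply: eq_ev => s sk.
    rewrite /phi (_ : map opair (map otau s) = map neg_fst (map opair s)); last first.
      by rewrite -!map_comp; apply: eq_map => v; apply: opair_tau.
    rewrite sdi_map (ev_map _ (map neg_fst)) /pm ev_addb; congr addb.
    apply: eq_ev => t ts; rewrite -[false]/(~~ true) -alternating_opp /= -!map_comp.
    congr alternating; apply/eq_in_map => p pt /=.
    have [_ p1 p2] := half_chain_sdi (leqW k4) sk ts pt.
    by rewrite lab_neg //; apply/eqP => p0; [move: p1|move: p2];
      rewrite p0 normr0 mulr0 ler10.
  - move=> s; rewrite /phi (_ : map opair _ = map swap_pair (map opair s)); last first.
      by rewrite -!map_comp; apply: eq_map => v; apply: opair_swap.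
    rewrite sdi_map (ev_map _ (map swap_pair)); apply: eq_ev => t _ /=.
    by congr alternating; rewrite -map_comp; apply: eq_map => p; apply: lab_swap.
  - move=> s; rewrite /phi (_ : map opair _ = map -%R (map opair s)); last first.
      by rewrite -!map_comp; apply: eq_map => v; apply: opair_neg.
    rewrite sdi_map (ev_map _ (map -%R)); apply: eq_ev => t _ /=.
    by congr alternating; rewrite -map_comp; apply: eq_map => p; apply: lab_opp.
have a0 : a 0%N = true.
  (* The vertex coded 22. It is its own subdivision, and a single label alternates with its own
     sign. *)
  pose v : overt := ((false, 1%N), (false, 1%N)); pose p := opair v.
  rewrite /a (_ : half_chain 0 = [:: [:: v]]) // {1}/ev big_seq1.
  rewrite (_ : map opair _ = [:: p]) //.
  have -> : sdi r 1 [:: p] = [:: [:: p]].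
    elim: r {nocompl nc a aS} => //= r IH.
    by rewrite /bary /= big_seq1 invr1 scale1r IH.
  rewrite /ev big_seq1 /pm (_ : map lab _ = [:: lab p]) //.
  by case: (lab p) => i [].
have a4 : a 4%N = false.
  rewrite /a (eq_ev (psi := fun=> false)); first by rewrite ev_count count_pred0.
  move=> s sk; rewrite (eq_ev (psi := fun=> false)).
    by rewrite ev_count count_pred0.
  move=> t ts; have szt : size (map lab t) = 5%N.
    by rewrite size_map (size_sdi _ ts) // size_map (size_half_chain _ sk).
  by rewrite /pm !alternating_size ?lab_lt // szt.
by move: a0; rewrite -aS // -aS // -aS // -aS // a4.
Qed.

(** * Accumulation of the edges with opposite labels *)

Lemma complementary_pair (r : nat) : exists p q : V,
  [/\ [/\ `|p| <= 1, 1 <= 3 * `|p.1| & 1 <= 3 * `|p.2|],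
      `|p - q| <= (4 / 5) ^+ r * 2 &
      exists i, [/\ (0 < f i p) != (0 < f i q),
        forall j, `|f j p| <= `|f i p| & forall j, `|f j q| <= `|f i q|]].
Proof.
have [k [s [t [k5 sk ts /hasP[_ /mapP[p pt ->] /mapP[q qt pq]]]]]] :=
  complementary_simplex r.
exists p, q; split; first exact: half_chain_sdi ts pt.
  (* The simplices have at most five vertices; before subdivision these have norm 1, whence the
     diameter bound 2. *)
  have -> : 4 / 5 = 1 - 5%:R^-1 :> R by lra.
  apply: (sdi_diam (N := 5%N) _ _ _ _ ts) => //.
    by rewrite size_map (size_half_chain k5 sk).
  move=> _ _ /mapP[v vs ->] /mapP[w ws ->].
  rewrite (le_trans (ler_normB _ _)) // !norm_opair.
  by [].
have [i [li mi]] := max_labelP (fun i => f i p).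
have [j [lj mj]] := max_labelP (fun i => f i q).
move: pq; rewrite /opp_label /lab li lj /= => -[/val_inj ij pq].
subst j; exists i; split => //.
by rewrite -pq; case: (0 < f i p).
Qed.

(** This refutes [f_nz] for continuous functions: the edges cluster at a point [c] with nonzero
    components, and there a sign change of a dominating function forces all functions to vanish. *)
Lemma no_zero_discontinuous :
  (forall i (p : V), p.1 != 0 -> p.2 != 0 -> {for p, continuous (f i)}) -> False.
Proof.
move=> f_cont.
have [u uP] := choice complementary_pair.
have I1 : compact (`[-1, 1]%classic : set R) by exact: segment_compact.
pose B3 : set V3 := (`[-1, 1] `*` `[-1, 1]) `*` `[-1, 1].
have cB3 : compact B3 by apply: compact_setX => //; apply: compact_setX.
have cB : compact (B3 `*` B3) by exact: compact_setX.
have B3P (x : V3) : `|x| <= 1 -> B3 x.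
  rewrite !prod_normE /= !ge_max => /andP[/andP[x1 x2] x3].
  by split; [split|]; rewrite /= in_itv /= -ler_norml.
have uB : (u @ \oo) (B3 `*` B3).
  exists 0%N => // r _ /=; have [q [[up _ _] _ _]] := uP r.
  by move: up; rewrite prod_normE ge_max => /andP[/B3P ? /B3P ?].
have [c [_ cc]] := cB _ _ uB.
have near_c (d : R) : 0 < d -> forall N : nat, exists2 r, (N <= r)%N & `|u r - c| < d.
  move=> d0 N.
  have := cc (u @` [set r | (N <= r)%N]) (ball c d) _ (nbhsx_ballx c d d0).
  case.
    by exists N => // r /= Nr; exists r.
  move=> _ [[r Nr <-]]; rewrite -ball_normE /= distrC => ?; by exists r.
have le_fst (p : V) : `|p.1| <= `|p| by rewrite [leRHS]prod_normE le_max lexx.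
have le_snd (p : V) : `|p.2| <= `|p| by rewrite [leRHS]prod_normE le_max lexx orbT.
have c1 : c.1 != 0.
  have [r _ rc] := near_c 3^-1 ltac:(by rewrite invr_gt0) 0%N.
  have [q [[_ u1 _] _ _]] := uP r; apply/eqP => c0.
  have := le_fst (u r - c); rewrite /= c0 subr0; lra.
have c2 : c.2 != 0.
  have [r _ rc] := near_c 3^-1 ltac:(by rewrite invr_gt0) 0%N.
  have [q [[_ _ u2] _ _]] := uP r; apply/eqP => c0.
  have := le_snd (u r - c); rewrite /= c0 subr0; lra.
have [j fj] := f_nz c1 c2.
(* Near [c] the values of [f j] exceed 2 e in absolute value, hence so do the dominating values of
   [f i] at both ends of the edge. These have opposite signs, yet both lie within e of [f i c]. *)
pose e := `|f j c| / 3.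
have e0 : 0 < e by rewrite divr_gt0 ?normr_gt0.
have : \forall q \near c, forall i, `|f i c - f i q| < e.
  apply: (@filter_forall _ _ (fun i q => `|f i c - f i q| < e) _ (nbhs_filter c)) => i.
  by apply: cvgr_dist_lt => //; apply: f_cont.
move=> /nbhs_ballP[d /= d0]; rewrite -ball_normE /= => cd.
have d20 : 0 < d / 2 by rewrite divr_gt0.
have [N _ Nd] : \forall r \near \oo, (4 / 5) ^+ r * 2 < d / 2 :> R.
  have : ((4 / 5 : R) ^+ r * 2) @[r --> \oo] --> (0 * 2 : R).
    apply: cvgMl; apply: cvg_expr; rewrite ger0_norm; lra.
  rewrite mul0r => /cvgr_lt; apply; exact: d20.
have [r Nr rc] := near_c _ d20 N.
have [q [_ uq [i [sgn mu mq]]]] := uP r.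
have {}Nd := Nd r Nr.
have uc i' : `|f i' c - f i' (u r)| < e.
  by apply: cd; rewrite /= distrC; lra.
have qc i' : `|f i' c - f i' q| < e.
  apply: cd; rewrite /= -(subrK (u r) c) -addrA (le_lt_trans (ler_normD _ _)) //.
  by rewrite (distrC c); lra.
have h1 := uc i; have h2 := qc i; have h3 := uc j; have h4 := qc j.
have h5 := mu j; have h6 := mq j.
have h7 := ler_normD (f j c - f j (u r)) (f j (u r)).
have h8 := ler_normD (f j c - f j q) (f j q).
rewrite subrK in h7; rewrite subrK in h8.
have eE : `|f j c| = 3 * e by rewrite /e; lra.
move: h1 h2; rewrite !ltr_distlC => /andP[a1 a2] /andP[b1 b2].
move: sgn h5 h6; case: (ltrP 0 (f i (u r))) => s1; case: (ltrP 0 (f i q)) => s2 // _.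
  rewrite (gtr0_norm s1) (ler0_norm s2); lra.
rewrite (ler0_norm s1) (gtr0_norm s2); lra.
Qed.

End BorsukUlam.

Theorem symmetric_odd_zero (R : realType) (f : 'I_4 -> R * R * R * (R * R * R) -> R) :
  (forall i p, f i (swap_pair p) = f i p) ->
  (forall i p, f i (neg_fst p) = - f i p) ->
  (forall i p, p.1 != 0 -> p.2 != 0 -> {for p, continuous (f i)}) ->
  exists p, [/\ p.1 != 0, p.2 != 0 & forall i, f i p = 0].
Proof.
move=> f_swap f_neg f_cont; apply: contrapT => nz.
apply: (no_zero_discontinuous f_swap f_neg _ f_cont) => p p1 p2.
apply: contrapT => all0; apply: nz; exists p; split => // i.
by apply/eqP/negPn/negP => fi; apply: all0; exists i.
Qed.


(** * The test functions of a mass distribution *)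

Section MassDistribution.
Variable R : realType.
Variable mu : {measure set (R * R)%type -> \bar R}.
Hypothesis mu_mass : mass_distribution mu.
Implicit Types (l : R * R * R) (p q : R * R * R * (R * R * R)) (x : R * R).

Let mu_fin A : measurable A -> mu A \is a fin_num.
Proof.
move=> mA; have [_ muT _] := mu_mass; rewrite ge0_fin_numE //.
by rewrite (le_lt_trans _ muT) // le_measure ?inE.
Qed.

Lemma fine_measure_dist A B E : measurable A -> measurable B -> measurable E ->
  A `<=` B `|` E -> B `<=` A `|` E -> `|fine (mu A) - fine (mu B)| <= fine (mu E).
Proof.
move=> mA mB mE AB BA.
have le C D : measurable C -> measurable D -> C `<=` D `|` E ->
    fine (mu C) <= fine (mu D) + fine (mu E).
  move=> mC mD CD; rewrite -fineD ?mu_fin // fine_le ?fin_numD ?mu_fin //.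
  apply: le_trans (measureU2 _ mD mE).
  by rewrite le_measure ?inE //; exact: measurableU.
have := le _ _ mA mB AB; have := le _ _ mB mA BA.
by rewrite ler_norml => ? ?; apply/andP; split; lra.
Qed.

Lemma eq_measure_null A B Z : measurable A -> measurable B -> measurable Z ->
  mu Z = 0%E -> A `<=` B `|` Z -> B `<=` A `|` Z -> mu A = mu B.
Proof.
move=> mA mB mZ Z0 AB BA; have := fine_measure_dist mA mB mZ AB BA.
rewrite Z0 normr_le0 subr_eq0 => /eqP e.
by rewrite -(fineK (mu_fin mA)) e fineK // mu_fin.
Qed.

Lemma measurable_aff_fun l : measurable_fun setT (aff_fun l).
Proof.
rewrite /aff_fun; apply: measurable_funD => //; apply: measurable_funD;
  exact: measurable_funM.
Qed.

Let measurable_preitv (h : R * R -> R) (i : interval R) :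
  measurable_fun setT h -> measurable [set x | h x \in i].
Proof.
move=> mh; have := mh measurableT [set` i] (measurable_itv i).
by rewrite setTI.
Qed.

Let zero l := [set x | aff_fun l x = 0].

Lemma measurable_zero l : measurable (zero l).
Proof.
have := measurable_aff_fun l measurableT (measurable_set1 0).
by rewrite setTI.
Qed.

Lemma measure_zero l : l != 0 -> mu (zero l) = 0%E.
Proof.
move=> l0; have [_ _ null] := mu_mass.
have [ab|] := eqVneq l.1 0; last first.
  move=> ab; apply: (null l.1.1 l.1.2 l.2) => //; exact: measurable_zero.
(* For the line at infinity the affine function is a nonzero constant. *)
rewrite (_ : zero l = set0) ?measure0 //; apply/seteqP; split => // x /=.
rewrite /zero /aff_fun /= ab /= !mul0r !add0r => l2.
by move/eqP: l0; apply; case: (l) ab l2 => a b /= -> ->.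
Qed.

(** Strict signs replace the closed sides, so that reversing a line exchanges the two parts
    exactly. *)
Definition pos_part p := [set x | 0 < aff_fun p.1 x * aff_fun p.2 x].
Definition neg_part p := [set x | aff_fun p.1 x * aff_fun p.2 x < 0].

Lemma measurable_pos_part p : measurable (pos_part p).
Proof.
have := @measurable_preitv (fun x => aff_fun p.1 x * aff_fun p.2 x) `]0, +oo[.
rewrite (_ : [set x | _] = pos_part p); last first.
  by apply/seteqP; split => x /=; rewrite in_itv /= andbT.
by apply; apply: measurable_funM; apply: measurable_aff_fun.
Qed.

Lemma measurable_neg_part p : measurable (neg_part p).
Proof.
have := @measurable_preitv (fun x => aff_fun p.1 x * aff_fun p.2 x) `]-oo, 0[.
rewrite (_ : [set x | _] = neg_part p); last first.
  by apply/seteqP; split => x /=; rewrite in_itv.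
by apply; apply: measurable_funM; apply: measurable_aff_fun.
Qed.

Definition imbalance p : R := fine (mu (pos_part p)) - fine (mu (neg_part p)).

Lemma imbalance_swap p : imbalance (swap_pair p) = imbalance p.
Proof.
rewrite /imbalance; congr (fine (mu _) - fine (mu _));
  by apply/seteqP; split => x /=; rewrite /pos_part /neg_part /= mulrC.
Qed.

Lemma aff_funN l x : aff_fun (- l) x = - aff_fun l x.
Proof. by rewrite /aff_fun /=; ring. Qed.

Lemma imbalance_neg p : imbalance (neg_fst p) = - imbalance p.
Proof.
rewrite /imbalance opprB; congr (fine (mu _) - fine (mu _));
  apply/seteqP; split => x /=;
  by rewrite /pos_part /neg_part /= aff_funN mulNr (oppr_gt0, oppr_lt0).
Qed.

(** * Continuity of the imbalance *)

Let weight x : R := `|x.1| + `|x.2| + 1.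

Let weight_gt0 x : 0 < weight x.
Proof. by rewrite /weight ltr_wpDl // addr_ge0. Qed.

Lemma aff_fun_dist l m x : `|aff_fun l x - aff_fun m x| <= `|l - m| * weight x.
Proof.
have -> : aff_fun l x - aff_fun m x =
    (l - m).1.1 * x.1 + (l - m).1.2 * x.2 + (l - m).2 by rewrite /aff_fun /=; ring.
move: (l - m) => k.
have [n1 n2 n3] := norm_coords_le k.
rewrite /weight !mulrDr mulr1 (le_trans (ler_normD _ _)) // lerD //.
by rewrite (le_trans (ler_normD _ _)) // lerD // normrM ler_wpM2r.
Qed.

(* The points whose side of the line [l] may change when the coefficients of
   [l] move by less than [1 / (n + 1)]. *)
Let strip l (n : nat) := [set x | `|aff_fun l x| <= n.+1%:R^-1 * weight x].

Lemma measurable_strip l n : measurable (strip l n).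
Proof.
have := @measurable_preitv (fun x => `|aff_fun l x| - n.+1%:R^-1 * weight x) `]-oo, 0].
rewrite (_ : [set x | _] = strip l n); last first.
  by apply/seteqP; split => x /=; rewrite in_itv /= subr_le0.
apply; apply: measurable_funB.
  by apply: measurableT_comp => //; apply: measurable_aff_fun.
apply: measurable_funM => //; apply: measurable_funD => //; apply: measurable_funD;
  exact: measurableT_comp.
Qed.

Lemma strip_sign l m n x : ~ strip l n x -> `|m - l| < n.+1%:R^-1 ->
  (0 < aff_fun m x) = (0 < aff_fun l x) /\ (aff_fun m x < 0) = (aff_fun l x < 0).
Proof.
move=> /negP; rewrite -ltNge => lx ml.
have : `|aff_fun m x - aff_fun l x| < `|aff_fun l x|.
  apply: le_lt_trans (aff_fun_dist _ _ _) _; apply: le_lt_trans lx.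
  by rewrite ler_wpM2r // ltW.
rewrite ltr_norml => /andP[h1 h2].
have [l0|l0|l0] := ltrgtP (aff_fun l x) 0.
- rewrite ltr0_norm // in h1 h2; split; [apply/negbTE; rewrite -leNgt|]; lra.
- rewrite gtr0_norm // in h1 h2; split; [|apply/negbTE; rewrite -leNgt]; lra.
- by rewrite l0 normr0 in h1 h2; lra.
Qed.

(** The strips decrease to the zero set of [aff_fun l], which is null, and the finite measure is
    continuous from above. *)
Lemma measure_strip_cvg l : l != 0 -> fine (mu (strip l n)) @[n --> \oo] --> (0 : R).
Proof.
move=> l0.
have capE : \bigcap_n strip l n = zero l.
  apply/seteqP; split => x /=; last first.
    by move=> xl n _; rewrite /strip /= xl normr0 mulr_ge0 // ltW.
  move=> xs; apply/eqP; rewrite -normr_le0 leNgt; apply/negP => gx.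
  have [n _ nx] : \forall n \near \oo, n.+1%:R^-1 < `|aff_fun l x| / weight x.
    by apply: near_infty_natSinv_lt (PosNum _); rewrite divr_gt0.
  have := xs n I; rewrite /strip /= leNgt -ltr_pdivlMr //.
  by rewrite nx /=.
have := @nonincreasing_cvg_mu _ _ _ mu (strip l) _ (measurable_strip l).
rewrite capE measure_zero // => /(_ _ (measurable_zero l)) cvg0.
apply: fine_cvg; rewrite -[_%:E]/0%E; apply: cvg0.
  by rewrite ltey_eq mu_fin //; exact: measurable_strip.
move=> m n mn; apply/subsetPset => x; rewrite /strip /= => /le_trans; apply.
apply: ler_wpM2r; first exact: ltW.
by rewrite lef_pV2 ?posrE // ler_nat ltnS.
Qed.

Lemma imbalance_continuous p : p.1 != 0 -> p.2 != 0 ->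
  {for p, continuous imbalance}.
Proof.
move=> p1 p2; apply/cvgrPdist_lt => e e0.
(* Signs change only inside two strips, each of measure below e / 4. Both measures in the imbalance
   thus move by less than e / 2. *)
have e4 : 0 < e / 4 by rewrite divr_gt0.
have [n [n1 n2]] : exists n, fine (mu (strip p.1 n)) < e / 4 /\
    fine (mu (strip p.2 n)) < e / 4.
  have /cvgr_lt/(_ _ e4) := measure_strip_cvg p1.
  have /cvgr_lt/(_ _ e4) := measure_strip_cvg p2.
  move=> [a _ ha] [b _ hb]; exists (maxn a b); split.
    by apply: hb => /=; exact: leq_maxr.
  by apply: ha => /=; exact: leq_maxl.
pose E := strip p.1 n `|` strip p.2 n.
have mE : measurable E by apply: measurableU; exact: measurable_strip.
have Ee : fine (mu E) < e / 2.
  have : fine (mu E) <= fine (mu (strip p.1 n)) + fine (mu (strip p.2 n)).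
    rewrite -fineD ?mu_fin //; try exact: measurable_strip.
    rewrite fine_le ?fin_numD ?mu_fin ?measureU2 //; exact: measurable_strip.
  lra.
have n0 : 0 < n.+1%:R^-1 :> R by rewrite invr_gt0.
near=> q.
have pq : `|q - p| < n.+1%:R^-1.
  by rewrite distrC; near: q; apply: (cvgr_dist_lt idfun) => //; exact: cvg_id.
have pq1 : `|q.1 - p.1| < n.+1%:R^-1.
  by apply: le_lt_trans pq; rewrite [leRHS]prod_normE le_max lexx.
have pq2 : `|q.2 - p.2| < n.+1%:R^-1.
  by apply: le_lt_trans pq; rewrite [leRHS]prod_normE le_max lexx orbT.
have sgnE x : ~ E x -> pos_part q x = pos_part p x /\ neg_part q x = neg_part p x.
  move=> /not_orP[/strip_sign/(_ pq1)[s1 s2] /strip_sign/(_ pq2)[s3 s4]].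
  have mulE (a b : R) : (0 < a * b) = (0 < a) && (0 < b) || (a < 0) && (b < 0).
    by case: (ltrgtP a 0) => [a0|a0|->]; rewrite ?mul0r ?ltxx //=;
      rewrite ?(pmulr_rgt0 _ a0) ?(nmulr_rgt0 _ a0) ?orbF.
  have mulNE (a b : R) : (a * b < 0) = (0 < a) && (b < 0) || (a < 0) && (0 < b).
    by case: (ltrgtP a 0) => [a0|a0|->]; rewrite ?mul0r ?ltxx //=;
      rewrite ?(pmulr_rlt0 _ a0) ?(nmulr_rlt0 _ a0) ?orbF.
  by rewrite /pos_part /neg_part /= !mulE !mulNE s1 s2 s3 s4.
have dist S : (forall q, measurable (S q)) ->
    (forall x, ~ E x -> S q x = S p x) ->
    `|fine (mu (S p)) - fine (mu (S q))| <= fine (mu E).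
  move=> mS SE; apply: fine_measure_dist => // x Sx;
    by have [Ex|/SE eS] := pselect (E x); [right|left; rewrite ?eS // -eS].
have d1 := dist _ measurable_pos_part (fun x Ex => (sgnE x Ex).1).
have d2 := dist _ measurable_neg_part (fun x Ex => (sgnE x Ex).2).
rewrite /imbalance opprD addrACA -opprD.
apply: le_lt_trans (ler_normB _ _) _; lra.
Unshelve. all: by end_near.
Qed.

(** Off the two null lines, the product is positive exactly when the point is on the positive side
    of both lines or of neither, that is, when [lam] is even. *)
Lemma imbalance_eq0 p : p.1 != 0 -> p.2 != 0 -> imbalance p = 0 ->
  sim_bisects [:: p.1; p.2] mu.
Proof.
move=> p1 p2 /eqP; rewrite subr_eq0 => /eqP imb.
pose Z := zero p.1 `|` zero p.2.
have mZ : measurable Z by apply: measurableU; exact: measurable_zero.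
have muZ : mu Z = 0%E.
  by apply: null_set_setU; rewrite ?measure_zero //; exact: measurable_zero.
have mnn l : measurable [set x | 0 <= aff_fun l x].
  have := @measurable_preitv (aff_fun l) `[0, +oo[.
  rewrite (_ : [set x | _] = [set x | 0 <= aff_fun l x]); last first.
    by apply/seteqP; split => x /=; rewrite in_itv /= andbT.
  by apply; exact: measurable_aff_fun.
have RpE : Rplus [:: p.1; p.2] = ~` Rminus [:: p.1; p.2].
  by apply/seteqP; split => x; rewrite /Rplus /Rminus /= => /negP.
have mRm : measurable (Rminus [:: p.1; p.2]).
  rewrite (_ : Rminus _ = ([set x | 0 <= aff_fun p.1 x] `\` [set x | 0 <= aff_fun p.2 x])
    `|` ([set x | 0 <= aff_fun p.2 x] `\` [set x | 0 <= aff_fun p.1 x])).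
    by apply: measurableU; apply: measurableD; exact: mnn.
  apply/seteqP; split => x; rewrite /Rminus /lam /=;
    case: (0 <= aff_fun p.1 x) => /=; case: (0 <= aff_fun p.2 x) => //=.
  - by left.
  - by right.
  - by move=> [[]|[]].
  - by move=> [[]|[]].
have mRp : measurable (Rplus [:: p.1; p.2]) by rewrite RpE; exact: measurableC.
have nzP x : ~ Z x -> (pos_part p x <-> Rplus [:: p.1; p.2] x) /\
    (neg_part p x <-> Rminus [:: p.1; p.2] x).
  move=> /not_orP[/eqP g1 /eqP g2].
  rewrite /pos_part /neg_part /Rplus /Rminus /lam /=.
  case: (ltrgtP (aff_fun p.1 x) 0) g1 => // a0 _;
    case: (ltrgtP (aff_fun p.2 x) 0) g2 => // b0 _ /=;
    rewrite ?(pmulr_rgt0 _ a0) ?(nmulr_rgt0 _ a0) ?(pmulr_rlt0 _ a0) ?(nmulr_rlt0 _ a0);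
    by rewrite ?b0 ?(ltNge _ 0) ?(ltNge 0) ?(ltW b0).
rewrite /sim_bisects.
have -> : mu (Rplus [:: p.1; p.2]) = mu (pos_part p).
  apply: (eq_measure_null _ _ mZ muZ) => //; first exact: measurable_pos_part.
    by move=> x Rx; have [Zx|/nzP[h _]] := pselect (Z x); [right|left; apply/h].
  by move=> x Rx; have [Zx|/nzP[h _]] := pselect (Z x); [right|left; apply/h].
have -> : mu (Rminus [:: p.1; p.2]) = mu (neg_part p).
  apply: (eq_measure_null _ _ mZ muZ) => //; first exact: measurable_neg_part.
    by move=> x Rx; have [Zx|/nzP[_ h]] := pselect (Z x); [right|left; apply/h].
  by move=> x Rx; have [Zx|/nzP[_ h]] := pselect (Z x); [right|left; apply/h].
rewrite -(fineK (mu_fin (measurable_pos_part p))) imb fineK //.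
exact: mu_fin (measurable_neg_part p).
Qed.

End MassDistribution.

Theorem theorem2 (R : realType)
  (mu : 'I_4 -> {measure set (R * R)%type -> \bar R}) :
  (forall i, mass_distribution (mu i)) ->
  exists l1 l2 : R * R * R,
    oline_nondeg l1 /\ oline_nondeg l2 /\
    forall i, sim_bisects [:: l1; l2] (mu i).
Proof.
move=> mass; have [p [p1 p2 p0]] := symmetric_odd_zero
  (fun i => @imbalance_swap R (mu i)) (fun i => @imbalance_neg R (mu i))
  (fun i => imbalance_continuous (mass i)).
by exists p.1, p.2; split=> //; split=> // i; apply: imbalance_eq0.
Qed.
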